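(* There exist absolute constants $C, C'>0$ such that the following holds. Let $n,d\ge 1$, let $\alpha\in(0,1]$ and let $\eta\in\mathbb R^n$ be a deterministic vector with $|\{i\in[n]: |\eta_i|\le 1\}|\ge \alpha n$. Let $\mathbf X\in\mathbb R^{n\times d}$ have i.i.d. entries $\mathbf X_{ij}\sim N(0,1)$. Let $\delta\in(0,1)$ and suppose $n\ge C\cdot \frac{d+\ln(2/\delta)}{\alpha^2}$. Then with probability at least $1-\delta$ over $\mathbf X$, simultaneously for every $\beta^*\in\mathbb R^d$ the following holds: with $\mathbf y=\mathbf X\beta^*+\eta$, every minimizer $\hat\beta$ of the Huber loss $f(\beta)=\frac1n\sum_{i=1}^n\Phi\big((\mathbf X\beta-\mathbf y)_i\big)$ satisfies \[\|\beta^*-\hat\beta\|^2\le C'\cdot\frac{d+\ln(2/\delta)}{\alpha^2 n}.\]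
   Context: The Huber penalty $\Phi:\mathbb R\to\mathbb R_{\ge0}$ is $\Phi(t)=\tfrac12 t^2$ if $|t|\le 2$ and $\Phi(t)=2|t|-2$ otherwise. $\|\cdot\|$ is the Euclidean norm. *)

(* Defs.v *)
From HB Require Import structures.
From mathcomp Require Import all_boot all_order all_algebra.
From mathcomp Require Import all_classical all_reals all_analysis.
Set Implicit Arguments. Unset Strict Implicit. Unset Printing Implicit Defensive.
Import Order.TTheory GRing.Theory Num.Theory.
Local Open Scope classical_set_scope.
Local Open Scope ring_scope.

Definition huber {R : realType} (t : R) : R :=
  if `|t| <= 2 then t ^+ 2 / 2 else 2 * `|t| - 2.

Definition huber_loss {R : realType} (n d : nat) (X : 'M[R]_(n, d))
  (y : 'cV[R]_n) (beta : 'cV[R]_d) : R :=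
  n%:R^-1 * \sum_(i < n) huber ((X *m beta - y) i 0).

Definition sqnorm {R : realType} (d : nat) (v : 'cV[R]_d) : R :=
  \sum_(j < d) (v j 0) ^+ 2.

Definition is_huber_minimizer {R : realType} (n d : nat) (X : 'M[R]_(n, d))
  (y : 'cV[R]_n) (bhat : 'cV[R]_d) : Prop :=
  forall beta : 'cV[R]_d, huber_loss X y bhat <= huber_loss X y beta.

(* The family (X i j) of real random variables on P is mutually independent
   (product rule for every choice of measurable sets; taking B = setT for
   some indices gives all finite subfamilies). *)
Definition mutually_independent {R : realType} (dT : measure_display)
  (T : measurableType dT) (P : probability T R) (n d : nat)
  (X : 'I_n -> 'I_d -> T -> R) : Prop :=
  forall B : 'I_n -> 'I_d -> set R, (forall i j, measurable (B i j)) ->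
    P (\bigcap_(k in [set: 'I_n * 'I_d]) (X k.1 k.2 @^-1` B k.1 k.2)) =
    (\prod_(k : 'I_n * 'I_d) P (X k.1 k.2 @^-1` B k.1 k.2))%E.

Definition std_gaussian {R : realType} (dT : measure_display)
  (T : measurableType dT) (P : probability T R) (X : T -> R) : Prop :=
  measurable_fun setT X /\
  forall B : set R, measurable B -> P (X @^-1` B) = normal_prob 0 1 B.

Definition data_matrix {R : realType} (T : Type) (n d : nat)
  (X : 'I_n -> 'I_d -> T -> R) (w : T) : 'M[R]_(n, d) :=
  \matrix_(i < n, j < d) X i j w.

(* Main.v *)
(** Only u = bhat - bstar matters: it minimizes sum_i Phi((X u - eta)_i). By
    convexity of Phi, the increase of this sum from 0 to u is at least the
    linear term <z, u>, where z is a bounded combination of the rows of X and so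
    |z|^2 = O(n (d + ln (2/delta))), plus, over the at least alpha n indices with
    |eta_i| <= 1, the sum of min(t_i^2, |t_i|) / 2 with t = X u. Along every
    unit vector v the sum of min((X v)_i^2, 1) over these indices is of order
    alpha n, so the growth beats the linear term unless |u| is small.

    Uniformity in v comes from grid nets of the ball, whose size is
    exponential in the dimension. All probabilistic input is the exact moment
    generating function of linear forms in the entries of X. For the lower bound,
    exp(- min(q^2, 1)) is dominated by a signed combination of exponentials of
    q, so that the expectation of a product over the rows can be expanded and
    evaluated exactly. All bad events are controlled by one nonnegative random
    variable Z of mean at most delta, the good event being Z < 1. *)

Require Import Defs.
From HB Require Import structures.
From mathcomp Require Import all_boot all_order all_algebra.
From mathcomp Require Import all_classical all_reals all_analysis.
From mathcomp Require Import measurable_realfun.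
From mathcomp Require Import ring lra.
Import Order.TTheory GRing.Theory Num.Theory.
Import numFieldNormedType.Exports.
Import HBNNSimple.
Local Open Scope classical_set_scope.
Local Open Scope ring_scope.

(** * Expectations of products of independent variables *)

Lemma integral_weighted_nnsfun {R : realType} {d : measure_display}
  {T : measurableType d} (mu : {measure set T -> \bar R})
  (X W : T -> R) (g : {nnsfun R >-> R}) :
  measurable_fun setT X -> measurable_fun setT W -> (forall t, 0 <= W t) ->
  (\int[mu]_t (g (X t) * W t)%:E =
   \sum_(y \in range g) (y%:E * \int[mu]_t (\1_(g @^-1` [set y]) (X t) * W t)%:E))%E.
Proof.
move=> mX mW W0.
have mF y : measurable_fun setT
    (fun t => (\1_(g @^-1` [set y]) (X t) * W t)%:E).
  apply/measurable_EFinP; apply: measurable_funM => //.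
  by apply: measurableT_comp => //; exact: measurable_indic.
transitivity (\int[mu]_t (\sum_(y \in range g)
   (y%:E * (\1_(g @^-1` [set y]) (X t) * W t)%:E))%E)%E.
  apply: eq_integral => t _; rewrite fimfunE.
  rewrite !fsbig_finite//= mulr_suml -sumEFin; apply: eq_bigr => y _.
  by rewrite -EFinM mulrA.
have F0 y t : (0 <= y%:E * (\1_(g @^-1` [set y]) (X t) * W t)%:E)%E.
  rewrite -EFinM lee_fin mulrA mulr_ge0//.
  by have := @nnfun_muleindic_ge0 _ _ _ g y (X t); rewrite -EFinM lee_fin.
rewrite ge0_integral_fsum//; last by move=> y; exact: measurable_funeM.
apply: eq_fsbigr => y /set_mem[x _ <-].
by rewrite ge0_integralZl ?lee_fin//= => t _; rewrite lee_fin mulr_ge0.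
Qed.

(** Each side integrates [f] against the image of a weighted measure under [X1] or [X2]. The images
    agree on measurable sets, and simple approximations of [f] extend this by monotone convergence.
    The weights stand for the other factors of a product, so independence can be exploited without a
    product measure. *)
Lemma ge0_integral_eq_law {R : realType} {d1 d2 : measure_display}
  {T1 : measurableType d1} {T2 : measurableType d2}
  (m1 : {measure set T1 -> \bar R}) (m2 : {measure set T2 -> \bar R})
  (X1 W1 : T1 -> R) (X2 W2 : T2 -> R) (f : R -> R) :
  measurable_fun setT X1 -> measurable_fun setT W1 -> (forall t, 0 <= W1 t) ->
  measurable_fun setT X2 -> measurable_fun setT W2 -> (forall t, 0 <= W2 t) ->
  measurable_fun setT f -> (forall x, 0 <= f x) ->
  (forall B : set R, measurable B ->
    \int[m1]_t (\1_B (X1 t) * W1 t)%:E = \int[m2]_t (\1_B (X2 t) * W2 t)%:E)%E ->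
  (\int[m1]_t (f (X1 t) * W1 t)%:E = \int[m2]_t (f (X2 t) * W2 t)%:E)%E.
Proof.
move=> mX1 mW1 W10 mX2 mW2 W20 mf f0 eqB.
have mf' : measurable_fun setT (EFin \o f) by exact/measurable_EFinP.
pose g n := nnsfun_approx measurableT mf' n.
have approx_int d (T : measurableType d) (mu : {measure set T -> \bar R})
    (X W : T -> R) :
    measurable_fun setT X -> measurable_fun setT W -> (forall t, 0 <= W t) ->
    (\int[mu]_t (f (X t) * W t)%:E =
     limn (fun n => \int[mu]_t (g n (X t) * W t)%:E))%E.
  move=> mX mW W0.
  rewrite -monotone_convergence//.
  - apply: eq_integral => t _; apply/esym/cvg_lim => //.
    have gf : EFin \o g ^~ (X t) @ \oo --> (f (X t))%:E.
      by apply: cvg_nnsfun_approx => //= x _; rewrite lee_fin.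
    under eq_fun do rewrite EFinM; rewrite EFinM.
    apply: cvgeM => //; last exact: cvg_cst.
  - move=> n; apply/measurable_EFinP; apply: measurable_funM => //.
    exact: measurableT_comp.
  - by move=> n t _; rewrite lee_fin mulr_ge0.
  - move=> t _ n m nm; rewrite lee_fin ler_wpM2r//.
    by have /lefP := nd_nnsfun_approx measurableT mf' nm; apply.
rewrite !approx_int//; congr (limn _); apply/funext => n.
rewrite !integral_weighted_nnsfun//; apply: eq_fsbigr => y _.
by rewrite eqB.
Qed.

(** Completing the square turns the integrand into a multiple of the normal density with mean
    [a]. *)
Lemma integral_expR_normal_pdf {R : realType} (a : R) :
  (\int[lebesgue_measure]_x (expR (a * x) * normal_pdf 0 1 x)%:E =
   (expR (a ^+ 2 / 2))%:E)%E.
Proof.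
have E x : expR (a * x) * normal_pdf 0 1 x =
           expR (a ^+ 2 / 2) * normal_pdf a 1 x.
  rewrite !normal_pdfE ?oner_neq0//= /normal_fun.
  rewrite mulrCA [RHS]mulrCA -!expRD; congr (_ * expR _).
  by rewrite expr1n; field.
under eq_integral do rewrite E EFinM.
rewrite ge0_integralZl//=.
- by rewrite integral_normal_pdf mule1.
- by apply/measurable_EFinP; exact: measurable_normal_pdf.
- by move=> x _; rewrite lee_fin normal_pdf_ge0.
Qed.

Lemma prodr_indic {R : realType} {T : Type} (K : finType) (B : K -> set R)
  (X : K -> T -> R) t :
  \prod_k \1_(B k) (X k t) =
  \1_(\bigcap_(k in [set: K]) (X k @^-1` B k)) t :> R.
Proof.
rewrite indicE; have [|] := boolP (t \in _).
- move=> /set_mem h; rewrite big1// => k _.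
  by rewrite indicE mem_set//; exact: h.
- rewrite notin_setE => h.
  have [k hk] : exists k, ~ B k (X k t).
    by apply/existsNP => h'; apply: h => k _; exact: h'.
  by rewrite (bigD1 k)//= indicE memNset// mul0r.
Qed.

Section gaussian_family.
Context {R : realType} {dT : measure_display} {T : measurableType dT}.
Variables (P : probability T R) (K : finType) (X : K -> T -> R).
Hypothesis gaussX : forall k, std_gaussian P (X k).
Hypothesis indepX : forall B : K -> set R, (forall k, measurable (B k)) ->
  P (\bigcap_(k in [set: K]) (X k @^-1` B k)) =
  (\prod_(k : K) P (X k @^-1` B k))%E.

Let measX k : measurable_fun setT (X k). Proof. by have [] := gaussX k. Qed.

(** Mixed factors interpolate between two product rules: for empty [s] independence itself, for [s]
    exhausting [K] the moment generating function. The expectation of each factor is [e]. *)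
Let F (a : K -> R) (B : K -> set R) (s : seq K) (k : K) (x : R) : R :=
  if k \in s then expR (a k * x) else \1_(B k) x.

Let e (a : K -> R) (B : K -> set R) (s : seq K) (k : K) : R :=
  if k \in s then expR (a k ^+ 2 / 2) else fine (P (X k @^-1` B k)).

Let mF a B s k : measurable (B k) -> measurable_fun setT (F a B s k).
Proof.
move=> mB; rewrite /F; case: (k \in s); last exact: measurable_indic.
by apply: measurableT_comp => //; exact: measurable_funM.
Qed.

Let F_ge0 a B s k x : 0 <= F a B s k x.
Proof. by rewrite /F; case: ifP => // _; exact: expR_ge0. Qed.

Let e_ge0 a B s k : 0 <= e a B s k.
Proof. by rewrite /e; case: ifP => // _; rewrite ?expR_ge0// fine_ge0. Qed.

(** Induction on [s] trades one indicator at a time for an exponential. [B] stays general because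
    the law of the new coordinate is tested on every measurable set. *)
Let integral_prod_mixed (a : K -> R) (s : seq K) (B : K -> set R) :
  uniq s -> (forall k, measurable (B k)) ->
  (\int[P]_t (\prod_k F a B s k (X k t))%:E = (\prod_k e a B s k)%:E)%E.
Proof.
elim: s B => [|k0 s IH] B.
  move=> _ mB; rewrite /F /e/=.
  under eq_integral do rewrite prodr_indic.
  have mX k : measurable (X k @^-1` B k).
    by rewrite -[_ @^-1` _]setTI; exact: measX.
  rewrite integral_indic//; last first.
    by apply: fin_bigcap_measurable => //; exact: finite_finset.
  rewrite setIT; transitivity (\prod_k P (X k @^-1` B k))%E; first exact: indepX.
  rewrite -prodEFin; apply: eq_bigr => k _.
  by rewrite fineK// fin_num_measure.
move=> /= /andP[k0s us] mB.
pose W t := \prod_(k | k != k0) F a B s k (X k t).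
pose c := \prod_(k | k != k0) e a B s k.
have mW : measurable_fun setT W.
  have -> : W = fun t => \prod_k (if k != k0 then F a B s k (X k t) else 1).
    by apply/funext => t; rewrite /W big_mkcond.
  apply: measurable_prod => k _; case: (k != k0) => //.
  by apply: measurableT_comp => //; exact: mF.
have W0 t : 0 <= W t by apply: prodr_ge0 => k _; exact: F_ge0.
have c0 : 0 <= c by apply: prodr_ge0 => k _; exact: e_ge0.
have eqW t : \prod_k F a B (k0 :: s) k (X k t) = expR (a k0 * X k0 t) * W t.
  rewrite (bigD1 k0)//= /F mem_head; congr (_ * _).
  by apply: eq_bigr => k kk0; rewrite inE (negbTE kk0).
under eq_integral do rewrite eqW.
(* Under the weight [W], the law of [X k0] is [c] times the standard normal law, so the integral
   moves to the real line. *)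
transitivity
  (\int[lebesgue_measure]_x (expR (a k0 * x) * (c * normal_pdf 0 1 x))%:E)%E;
  last first.
  under eq_integral do rewrite mulrCA EFinM.
  rewrite ge0_integralZl//=.
  + rewrite integral_expR_normal_pdf -EFinM mulrC; congr EFin.
    rewrite [RHS](bigD1 k0)//=; congr (_ * _); first by rewrite /e mem_head.
    by apply: eq_bigr => k kk0; rewrite /e inE (negbTE kk0).
  + apply/measurable_EFinP; apply: measurable_funM.
      by apply: measurableT_comp => //; exact: measurable_funM.
    exact: measurable_normal_pdf.
  + by move=> x _; rewrite lee_fin mulr_ge0 ?expR_ge0 ?normal_pdf_ge0.
apply: (@ge0_integral_eq_law _ _ _ _ _ P lebesgue_measure (X k0) W
  (fun x : R => x) (fun x => c * normal_pdf 0 1 x) (fun x => expR (a k0 * x))) => //.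
- by apply: measurable_funM => //; exact: measurable_normal_pdf.
- by move=> x; rewrite mulr_ge0 ?normal_pdf_ge0.
- by apply: measurableT_comp => //; exact: measurable_funM.
(* Placing [B0] at coordinate [k0] reduces the agreement of the two laws to the induction
   hypothesis. *)
- move=> B0 mB0; pose B' k := if k == k0 then B0 else B k.
  have mB' k : measurable (B' k) by rewrite /B'; case: ifP.
  have -> : (\int[P]_t (\1_B0 (X k0 t) * W t)%:E =
             \int[P]_t (\prod_k F a B' s k (X k t))%:E)%E.
    apply: eq_integral => t _; congr EFin.
    rewrite [RHS](bigD1 k0)//=; congr (_ * _).
      by rewrite /F (negbTE k0s) /B' eqxx.
    by apply: eq_bigr => k kk0; rewrite /F /B' (negbTE kk0).
  rewrite IH//.
  under [RHS]eq_integral do rewrite mulrCA EFinM.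
  rewrite [RHS]ge0_integralZl//=.
  + rewrite (bigD1 k0)//= mulrC EFinM.
    congr (_ * _)%E.
      by congr EFin; apply: eq_bigr => k kk0; rewrite /e /B' (negbTE kk0).
    rewrite /e (negbTE k0s) /B' eqxx.
    rewrite fineK; last first.
      rewrite fin_num_measure// -[_ @^-1` _]setTI; exact: measX.
    have [_ ->//] := gaussX k0.
    rewrite /normal_prob integral_mkcond/=; apply: eq_integral => x _.
    by rewrite patchE indicE; case: ifP => _; rewrite ?mul1r ?mul0r.
  + apply/measurable_EFinP; apply: measurable_funM; last first.
      exact: measurable_normal_pdf.
    exact: measurable_indic.
  + by move=> x _; rewrite lee_fin mulr_ge0 ?normal_pdf_ge0.
Qed.

Lemma gaussian_mgf (a : K -> R) :
  (\int[P]_t (expR (\sum_k a k * X k t))%:E =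
   (expR ((\sum_k a k ^+ 2) / 2))%:E)%E.
Proof.
have := integral_prod_mixed a (enum K) (fun _ => setT) (enum_uniq K)
  (fun _ => measurableT).
have sE k : k \in enum K by rewrite mem_enum.
move=> mixed; rewrite mulr_suml expR_sum.
transitivity (\int[P]_t (\prod_k F a (fun=> setT) (enum K) k (X k t))%:E)%E.
  apply: eq_integral => t _; rewrite expR_sum; congr EFin.
  by apply: eq_bigr => k _; rewrite /F sE.
by rewrite mixed; congr EFin; apply: eq_bigr => k _; rewrite /e sE.
Qed.

End gaussian_family.

(** * Exponential moments of a Gaussian matrix *)

(** Integrability is included so that signed combinations can be integrated termwise. *)
Definition has_mean {R : realType} {dT : measure_display}
  {T : measurableType dT} (P : probability T R) (Z : T -> R) (z : R) : Prop :=
  P.-integrable setT (EFin \o Z) /\ (\int[P]_t (Z t)%:E = z%:E)%E.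

Section has_mean.
Context {R : realType} {dT : measure_display} {T : measurableType dT}.
Variable P : probability T R.

Lemma eq_has_mean (Z Z' : T -> R) (z z' : R) :
  has_mean P Z z -> Z =1 Z' -> z = z' -> has_mean P Z' z'.
Proof. by move=> h /funext <- <-. Qed.

Lemma has_mean0 : has_mean P (fun=> 0) 0.
Proof. by split; [exact: integrable0|rewrite integral0]. Qed.

Lemma has_meanD (Z1 Z2 : T -> R) (z1 z2 : R) :
  has_mean P Z1 z1 -> has_mean P Z2 z2 ->
  has_mean P (fun t => Z1 t + Z2 t) (z1 + z2).
Proof.
move=> [i1 e1] [i2 e2]; split; first exact: (integrableD measurableT i1 i2).
under eq_integral do rewrite EFinD.
by rewrite integralD// e1 e2.
Qed.

Lemma has_meanZ (c : R) (Z : T -> R) (z : R) :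
  has_mean P Z z -> has_mean P (fun t => c * Z t) (c * z).
Proof.
move=> [i e]; split; first exact: (integrableZl measurableT c i).
under eq_integral do rewrite EFinM.
by rewrite integralZl// e.
Qed.

Lemma has_mean_sum (I : Type) (r : seq I) (Q : pred I) (Z : I -> T -> R)
  (z : I -> R) : (forall i, has_mean P (Z i) (z i)) ->
  has_mean P (fun t => \sum_(i <- r | Q i) Z i t) (\sum_(i <- r | Q i) z i).
Proof.
move=> h; elim: r => [|i r IH].
  by apply: (eq_has_mean _ _ _ _ has_mean0) => [t|]; rewrite big_nil.
rewrite big_cons; case: ifPn => Qi.
  by apply: (eq_has_mean _ _ _ _ (has_meanD _ _ _ _ (h i) IH)) => // t; rewrite big_cons Qi.
by apply: (eq_has_mean _ _ _ _ IH) => // t; rewrite big_cons (negbTE Qi).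
Qed.

Lemma has_mean_markov (Z : T -> R) (z : R) :
  has_mean P Z z -> (forall t, 0 <= Z t) ->
  measurable [set t | Z t < 1] /\ ((1 - z)%:E <= P [set t | (Z t < 1)%R])%E.
Proof.
move=> [iZ eZ] Z0.
have mZ : measurable_fun setT Z.
  by apply/measurable_EFinP; exact: measurable_int iZ.
have mge : measurable [set t | 1 <= Z t].
  rewrite (_ : [set _ | _] = setT `&` (Z @^-1` `[1, +oo[)).
    exact: mZ.
  by rewrite setTI; apply/seteqP; split => t /=; rewrite in_itv/= andbT.
have cE : [set t | Z t < 1] = ~` [set t | 1 <= Z t].
  by apply/seteqP; split => t /=; rewrite ltNge => /negP.
have mlt : measurable [set t | Z t < 1] by rewrite cE; exact: measurableC.
split => //.
rewrite cE probability_setC// EFinB leeB//.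
rewrite -eZ -[X in (P X <= _)%E]setIT -integral_indic//.
apply: ge0_le_integral => //.
- by apply/measurable_EFinP; exact: measurable_indic.
- exact/measurable_EFinP.
move=> t _; rewrite lee_fin indicE; case: (boolP (t \in _)) => // /set_mem.
by [].
Qed.

End has_mean.

Section exponential_moments.
Context {R : realType} {dT : measure_display} {T : measurableType dT}.
Variables (P : probability T R) (d : nat).

(* Exact moment generating functions are the only feature of the Gaussian
   matrix that the argument needs. *)
Definition has_gaussian_mgf (n : nat) (X : 'I_n -> 'I_d -> T -> R) : Prop :=
  forall a : 'I_n -> 'I_d -> R,
  has_mean P (fun t => expR (\sum_i \sum_j a i j * X i j t))
             (expR ((\sum_i \sum_j a i j ^+ 2) / 2)).

Lemma gaussian_matrix_mgf (n : nat) (X : 'I_n -> 'I_d -> T -> R) :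
  (forall i j, std_gaussian P (X i j)) -> mutually_independent P X ->
  has_gaussian_mgf n X.
Proof.
move=> gX iX a; rewrite !pair_big/=.
have mX i j : measurable_fun setT (X i j) by have [] := gX i j.
have mE : measurable_fun setT
    (fun t => expR (\sum_i \sum_j a i j * X i j t)).
  apply: measurableT_comp => //; apply: measurable_sum => i.
  by apply: measurable_sum => j; exact: measurable_funM.
have iX' (B : 'I_n * 'I_d -> set R) : (forall k, measurable (B k)) ->
    P (\bigcap_(k in [set: 'I_n * 'I_d]) (X k.1 k.2 @^-1` B k)) =
    (\prod_(k : 'I_n * 'I_d) P (X k.1 k.2 @^-1` B k))%E.
  move=> mB; have -> : B = fun k => B (k.1, k.2) by apply/funext => -[].
  by have := iX (fun i j => B (i, j)) (fun i j => mB (i, j)).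
have h := gaussian_mgf P _ (fun k : 'I_n * 'I_d => X k.1 k.2)
  (fun k => gX k.1 k.2) iX' (fun k => a k.1 k.2).
have h' : (\int[P]_t (expR (\sum_i \sum_j a i j * X i j t))%:E =
    (expR ((\sum_(k : 'I_n * 'I_d) a k.1 k.2 ^+ 2) / 2))%:E)%E.
  by rewrite -h; apply: eq_integral => t _; rewrite pair_big.
split => //; apply/integrableP; split; first exact/measurable_EFinP.
under eq_integral do rewrite /= ger0_norm ?expR_ge0//.
by rewrite h' ltry.
Qed.

Lemma gaussian_mgf_rows (n m : nat) (X : 'I_n -> 'I_d -> T -> R)
  (g : 'I_m -> 'I_n) : injective g -> has_gaussian_mgf n X ->
  has_gaussian_mgf m (fun i => X (g i)).
Proof.
move=> ginj gX a.
(* Extend the coefficients by zero to the rows outside the range of [g]. *)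
pose b i j := if [pick k | g k == i] is Some k then a k j else 0.
have bg k j : b (g k) j = a k j.
  rewrite /b; case: pickP => [k' /eqP/ginj->//|/(_ k)].
  by rewrite eqxx.
pose A := finset.imset g (mem 'I_m).
have b0 i j : i \notin A -> b i j = 0.
  rewrite /b => gi; case: pickP => // k /eqP gk.
  by case/negP: gi; rewrite -gk; exact: imset_f.
have sumE (f : R -> 'I_n -> 'I_d -> R) : (forall i j, f 0 i j = 0) ->
    \sum_i \sum_j f (b i j) i j = \sum_k \sum_j f (a k j) (g k) j.
  move=> f0; rewrite (bigID (mem A))/=.
  rewrite [X in _ + X]big1 ?addr0; last first.
    by move=> i gi; apply: big1 => j _; rewrite b0.
  rewrite big_imset/=; last by move=> ? ? _ _ /ginj.
  by apply: eq_bigr => k _; apply: eq_bigr => j _; rewrite bg.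
apply: (eq_has_mean _ _ _ _ _ (gX b)) => [t|].
  by rewrite (sumE (fun x i j => x * X i j t))// => i j; rewrite mul0r.
by rewrite (sumE (fun x i j => x ^+ 2))// => i j; rewrite expr0n.
Qed.

(** Chernoff bounds take [s] to be [l] times a level, with [l] positive: the exponential is then
    below 1 exactly when the bilinear form is below that level. *)
Lemma bilinear_mgf (n : nat) (X : 'I_n -> 'I_d -> T -> R) (a : 'cV[R]_n)
  (w : 'cV[R]_d) (l s : R) : has_gaussian_mgf n X ->
  has_mean P
    (fun t => expR (l * (\sum_i \sum_j a i 0 * X i j t * w j 0) - s))
    (expR (l ^+ 2 * (sqnorm a * sqnorm w) / 2 - s)).
Proof.
move=> gX.
apply: (eq_has_mean _ _ _ _ _
  (has_meanZ _ (expR (- s)) _ _ (gX (fun i j => l * (a i 0 * w j 0))))).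
  move=> t; rewrite -expRD; congr expR; rewrite [LHS]addrC; congr (_ - _).
  rewrite mulr_sumr; apply: eq_bigr => i _; rewrite mulr_sumr.
  by apply: eq_bigr => j _; ring.
rewrite -expRD; congr expR; rewrite [LHS]addrC; congr (_ / _ - _).
rewrite /sqnorm mulr_suml mulr_sumr; apply: eq_bigr => i _.
rewrite 2!mulr_sumr; apply: eq_bigr => j _; by ring.
Qed.

(* Expanding the product turns any exponential polynomial of the rows into a
   signed combination of exponentials of linear forms. *)
Lemma exp_poly_rows_mean (m p : nat) (X : 'I_m -> 'I_d -> T -> R)
  (w : 'cV[R]_d) (kap th : 'I_p -> R) : has_gaussian_mgf m X ->
  has_mean P
   (fun t => \prod_i \sum_a kap a * expR (th a * \sum_j X i j t * w j 0))
   ((\sum_a kap a * expR (th a ^+ 2 * sqnorm w / 2)) ^+ m).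
Proof.
move=> gX.
(* A function [f] picks one exponential for each row. *)
have term (f : {ffun 'I_m -> 'I_p}) := has_meanZ P (\prod_i kap (f i)) _ _
  (gX (fun i j => th (f i) * w j 0)).
have := has_mean_sum P _ (index_enum {ffun 'I_m -> 'I_p}) xpredT _ _ term.
move/eq_has_mean; apply.
  move=> t; rewrite bigA_distr_bigA/=; apply: eq_bigr => f _.
  rewrite expR_sum -big_split/=; apply: eq_bigr => i _; congr (_ * expR _).
  by rewrite mulr_sumr; apply: eq_bigr => j _; ring.
rewrite -[m in RHS]card_ord -prodr_const bigA_distr_bigA/=.
apply: eq_bigr => f _.
rewrite mulr_suml expR_sum -big_split/=; apply: eq_bigr => i _.
have -> // : \sum_j (th (f i) * w j 0) ^+ 2 = th (f i) ^+ 2 * sqnorm w.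
by rewrite mulr_sumr; apply: eq_bigr => j _; rewrite exprMn.
Qed.

End exponential_moments.

(** * Nets of the Euclidean ball *)

Lemma sum_geometric_half_le2 {R : realType} (n : nat) :
  \sum_(k < n) (2^-1 : R) ^+ k <= 2.
Proof.
suff -> : \sum_(k < n) (2^-1 : R) ^+ k = 2 - 2 * 2^-1 ^+ n.
  by rewrite gerBl mulr_ge0// exprn_ge0// invr_ge0.
elim: n => [|n IH]; first by rewrite big_ord0 expr0; ring.
by rewrite big_ord_recr/= IH exprS; field.
Qed.

Lemma expR1_ge2 {R : realType} : 2 <= expR 1 :> R.
Proof. by have := expR_ge1Dx (1 : R). Qed.

Lemma sqnorm_ge0 {R : realType} (d : nat) (v : 'cV[R]_d) : 0 <= sqnorm v.
Proof. by apply: sumr_ge0 => j _; exact: sqr_ge0. Qed.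

(* Round each coordinate towards 0 to a multiple of h = sqrt (e / d); a grid
   point k with sum k_j^2 <= d / e is counted with weight
   exp (d / e - sum k_j^2) >= 1, and the total weight factorizes. *)
Lemma ball_net {R : realType} (d : nat) (e : R) : (1 <= d)%N -> 0 < e ->
  exists N : seq 'cV[R]_d,
  [/\ (size N)%:R <= expR ((2 + e^-1) * d%:R),
      forall w, w \in N -> sqnorm w <= 1 &
      forall v, sqnorm v <= 1 -> exists2 w, w \in N & sqnorm (v - w) <= e].
Proof.
move=> d1 e0; have d0 : 0 < d%:R :> R by rewrite ltr0n.
pose h := Num.sqrt (e / d%:R).
have h0 : 0 < h by rewrite sqrtr_gt0 divr_gt0.
have h2 : h ^+ 2 = e / d%:R by rewrite sqr_sqrtr// ltW// divr_gt0.
pose M := Num.truncn h^-1.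
pose I := {ffun 'I_d -> bool * 'I_M.+1}.
pose pt (f : I) : 'cV[R]_d := \col_j ((-1) ^+ (f j).1 * (h * (f j).2%:R)).
have ptE f : sqnorm (pt f) = \sum_j (h * (f j).2%:R) ^+ 2.
  apply: eq_bigr => j _; rewrite mxE exprMn sqrr_sign mul1r//.
pose N := [seq pt f | f <- [seq f <- enum {: I} | sqnorm (pt f) <= 1]].
exists N; split.
- rewrite size_map size_filter -sum1_count natr_sum big_enum_cond/=.
  apply: (@le_trans _ _ (\sum_(f : I) \prod_j
      (expR e^-1 * expR (- (f j).2%:R ^+ 2)))).
    rewrite big_mkcond/=; apply: ler_sum => f _; case: ifP => [|_]; last first.
      by apply: prodr_ge0 => j _; rewrite mulr_ge0 ?expR_ge0.
    rewrite ptE => pf1.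
    rewrite big_split/= -!expR_sum -expRD -[X in X <= _]expR0 ler_expR sumr_const card_ord.
    rewrite sumrN subr_ge0 -(ler_pM2l (exprn_gt0 2 h0)) mulr_sumr.
    under eq_bigr do rewrite -exprMn.
    rewrite (le_trans pf1)// h2 -[X in _ * X]mulr_natr.
    have -> : e / d%:R * (e^-1 * d%:R) = 1 by field; rewrite !gt_eqF.
    by [].
  rewrite (_ : \sum_(f : I) _ = \prod_(j < d) \sum_(x : bool * 'I_M.+1)
     (expR e^-1 * expR (- x.2%:R ^+ 2))); last by rewrite bigA_distr_bigA.
  rewrite prodr_const card_ord.
  rewrite mulrC expRM_natl lerXn2r ?nnegrE ?expR_ge0//.
    by apply: sumr_ge0 => x _; rewrite mulr_ge0 ?expR_ge0.
  rewrite -mulr_sumr addrC expRD ler_pM2l ?expR_gt0//.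
  rewrite -(pair_big xpredT xpredT (fun (_ : bool) (k : 'I_M.+1) =>
    expR (- k%:R ^+ 2)))/= sumr_const card_bool.
  have hk (k : 'I_M.+1) : expR (- k%:R ^+ 2) <= 2^-1 ^+ k :> R.
    apply: (@le_trans _ _ (expR (- k%:R))).
      rewrite ler_expR lerN2 -natrX ler_nat.
      by case: (nat_of_ord k) => // k'; rewrite expnS leq_pmulr// expn_gt0.
    rewrite expRN exprVn -[k%:R]mulr1 expRM_natl.
    by rewrite lef_pV2 ?posrE ?exprn_gt0 ?expR_gt0// lerXn2r ?nnegrE ?expR_ge0// expR1_ge2.
  have hs : \sum_(k < M.+1) expR (- k%:R ^+ 2) <= 2 :> R.
    by apply: le_trans (sum_geometric_half_le2 M.+1); exact: ler_sum.
  (* Two signs times a series of sum at most 2 give at most 4 per coordinate; this is the 2 in the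
     exponent of the net size. *)
  have h4 : 4 <= expR 2 :> R.
    have -> : 2 = 2%:R * 1 :> R by rewrite mulr1.
    rewrite expRM_natl; have := @expR1_ge2 R; nra.
  rewrite mulr2n; lra.
- by move=> w /mapP[f]; rewrite mem_filter => /andP[? _] ->.
- move=> v v1.
  have vj1 j : `|v j 0| <= 1.
    rewrite -(@expr_le1 _ 2)// real_normK ?num_real//.
    apply: le_trans v1; rewrite /sqnorm (bigD1 j)//= lerDl.
    by apply: sumr_ge0 => k _; exact: sqr_ge0.
  pose k j := Num.truncn (`|v j 0| / h).
  have kM j : (k j < M.+1)%N.
    rewrite ltnS /k /M; apply: le_truncn.
    by rewrite ler_piMl ?invr_ge0// ltW.
  have kP j : h * (k j)%:R <= `|v j 0| < h * (k j)%:R + h.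
    have /andP[] := truncn_itv (divr_ge0 (normr_ge0 (v j 0)) (ltW h0)).
    rewrite -/(k j) ler_pdivlMr// ltr_pdivrMr// -natr1 mulrDl mul1r.
    by rewrite mulrC => -> ->.
  pose f : I := [ffun j => (v j 0 < 0, Ordinal (kM j))].
  exists (pt f).
    apply: map_f; rewrite mem_filter mem_enum andbT ptE.
    apply: le_trans v1; apply: ler_sum => j _; rewrite ffunE/=.
    have /andP[hk _] := kP j.
    rewrite -[leRHS]real_normK ?num_real// lerXn2r ?nnegrE//.
    by rewrite mulr_ge0// ltW.
  apply: (@le_trans _ _ (\sum_(j < d) h ^+ 2)); last first.
    by rewrite sumr_const card_ord h2 -[X in X <= _]mulr_natr divfK ?gt_eqF.
  apply: ler_sum => j _; rewrite !mxE ffunE/=.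
  have /andP[] := kP j; move: (h * _) => z.
  case: (ltrP (v j 0) 0) => vj.
    by rewrite (ltr0_norm vj) /= expr1 => zv vz; nra.
  by rewrite (ger0_norm vj) /= expr0 => zv vz; nra.
Qed.

(** * Bounding Euclidean and operator norms through nets *)

Definition dot {R : realType} (d : nat) (a b : 'cV[R]_d) : R :=
  \sum_(j < d) a j 0 * b j 0.

Section euclidean.
Context {R : realType}.

Lemma dotDr (d : nat) (z a b : 'cV[R]_d) : dot d z (a + b) = dot d z a + dot d z b.
Proof. by rewrite -big_split/=; apply: eq_bigr => j _; rewrite mxE mulrDr. Qed.

Lemma dot_self (d : nat) (a : 'cV[R]_d) : dot d a a = sqnorm a.
Proof. by apply: eq_bigr => j _; rewrite expr2. Qed.

Lemma sqnormZ (d : nat) (c : R) (a : 'cV[R]_d) : sqnorm (c *: a) = c ^+ 2 * sqnorm a.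
Proof. by rewrite mulr_sumr; apply: eq_bigr => j _; rewrite mxE exprMn. Qed.

Lemma sqnorm_eq0 (d : nat) (a : 'cV[R]_d) : sqnorm a = 0 -> a = 0.
Proof.
move=> /eqP; rewrite psumr_eq0 => [/allP h|j _]; last exact: sqr_ge0.
apply/colP => j; rewrite mxE; apply/eqP.
by have := h j (mem_index_enum j); rewrite implyTb sqrf_eq0.
Qed.

Lemma sqnormD_le (d : nat) (p q : R) (a b : 'cV[R]_d) :
  (forall x y : R, (x + y) ^+ 2 <= p * x ^+ 2 + q * y ^+ 2) ->
  sqnorm (a + b) <= p * sqnorm a + q * sqnorm b.
Proof.
move=> pq; rewrite /sqnorm !mulr_sumr -big_split/=.
by apply: ler_sum => j _; rewrite mxE.
Qed.

Lemma dot_cauchy_schwarz (d : nat) (a b : 'cV[R]_d) :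
  dot d a b ^+ 2 <= sqnorm a * sqnorm b.
Proof.
have [b0|b0] := eqVneq (sqnorm b) 0.
  rewrite b0 mulr0 (sqnorm_eq0 _ _ b0) /dot big1 ?expr0n// => j _.
  by rewrite mxE mulr0.
have bgt0 : 0 < sqnorm b by rewrite lt_neqAle eq_sym b0 sqnorm_ge0.
have : 0 <= \sum_j (sqnorm b * a j 0 - dot d a b * b j 0) ^+ 2.
  by apply: sumr_ge0 => j _; exact: sqr_ge0.
have -> : \sum_j (sqnorm b * a j 0 - dot d a b * b j 0) ^+ 2 =
    sqnorm b ^+ 2 * sqnorm a - 2 * sqnorm b * dot d a b * dot d a b
    + dot d a b ^+ 2 * sqnorm b.
  rewrite (eq_bigr (fun j => sqnorm b ^+ 2 * a j 0 ^+ 2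
    - 2 * sqnorm b * dot d a b * (a j 0 * b j 0)
    + dot d a b ^+ 2 * b j 0 ^+ 2)); last by move=> j _; ring.
  by rewrite big_split/= sumrB -!mulr_sumr.
move: (dot d a b) (sqnorm a) (sqnorm b) bgt0 => D A B B0 h.
by rewrite -(ler_pM2l B0); nra.
Qed.

Definition is_net (d : nat) (N : seq 'cV[R]_d) (e : R) : Prop :=
  forall v, sqnorm v <= 1 -> exists2 w, w \in N & sqnorm (v - w) <= e.

Lemma unit_vector (d : nat) (v : 'cV[R]_d) : sqnorm v != 0 ->
  exists r u, [/\ 0 < r, sqnorm u = 1, v = r *: u & sqnorm v = r ^+ 2].
Proof.
move=> v0; have vgt0 : 0 < sqnorm v by rewrite lt_neqAle eq_sym v0 sqnorm_ge0.
pose r := Num.sqrt (sqnorm v); have r0 : 0 < r by rewrite sqrtr_gt0.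
have r2 : sqnorm v = r ^+ 2 by rewrite sqr_sqrtr// ltW.
exists r, (r^-1 *: v); split => //.
- by rewrite sqnormZ r2 exprVn mulVf// expf_neq0// gt_eqF.
- by rewrite scalerA divff ?gt_eqF// scale1r.
Qed.

(** A net point within distance 1/2 of the direction of [z] captures at least half of the norm of
    [z]. *)
Lemma net_sqnorm_le (d : nat) (N : seq 'cV[R]_d) (z : 'cV[R]_d) (t : R) :
  is_net d N 4^-1 -> 0 <= t -> (forall w, w \in N -> dot d z w <= t) ->
  sqnorm z <= 4 * t ^+ 2.
Proof.
move=> Nnet t0 Nz; have [->|z0] := eqVneq (sqnorm z) 0.
  by rewrite mulr_ge0// sqr_ge0.
have [r [v [r0 v1 zE z2]]] := unit_vector _ _ z0.
have [w wN vw] : exists2 w, w \in N & sqnorm (v - w) <= 4^-1.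
  by apply: Nnet; rewrite v1.
have zw := Nz _ wN.
have zv : dot d z v = r.
  by rewrite zE /dot; under eq_bigr do rewrite mxE -mulrA; rewrite -mulr_sumr
    -/(dot d v v) dot_self v1 mulr1.
have h : dot d z (v - w) <= r / 2.
  have -> : dot d z (v - w) = r * dot d v (v - w).
    by rewrite zE /dot mulr_sumr; apply: eq_bigr => j _; rewrite mxE mulrA.
  rewrite ler_pM2l//.
  apply: (@le_trans _ _ (4^-1 * sqnorm v + sqnorm (v - w))); last first.
    by rewrite v1; lra.
  rewrite /dot /sqnorm mulr_sumr -big_split/=; apply: ler_sum => j _.
  move: ((v - w) j 0) (v j 0) => x y.
  by have := sqr_ge0 (y / 2 - x); nra.
have : r = dot d z w + dot d z (v - w) by rewrite -dotDr addrC subrK zv.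
rewrite z2; nra.
Qed.

Definition mulcol (m d : nat) (x : 'I_m -> 'I_d -> R) (v : 'cV[R]_d) : 'cV[R]_m :=
  \col_i \sum_j x i j * v j 0.

Lemma mulcolD m d x v w : mulcol m d x (v + w) = mulcol m d x v + mulcol m d x w.
Proof.
apply/colP => i; rewrite !mxE -big_split/=.
by apply: eq_bigr => j _; rewrite mxE mulrDr.
Qed.

Lemma mulcolZ m d x c v : mulcol m d x (c *: v) = c *: mulcol m d x v.
Proof.
apply/colP => i; rewrite !mxE mulr_sumr.
by apply: eq_bigr => j _; rewrite mxE; ring.
Qed.

Lemma mulcol_frobenius m d x v :
  sqnorm (mulcol m d x v) <= (\sum_i \sum_j x i j ^+ 2) * sqnorm v.
Proof.
rewrite mulr_suml; apply: ler_sum => i _; rewrite mxE.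
have := dot_cauchy_schwarz d (\col_j x i j) v.
rewrite /dot {1}/sqnorm; under eq_bigr do rewrite mxE.
by under [X in _ <= X * _ -> _]eq_bigr do rewrite mxE.
Qed.

(* An a priori bound B on the squared operator norm improves to 8 t^2 + B / 2
   by comparing with the net, so the fixed point 16 t^2 is a bound too. *)
Lemma net_operator_norm m d x (Nm : seq 'cV[R]_m) (Nd : seq 'cV[R]_d) (t : R) :
  is_net m Nm 4^-1 -> is_net d Nd 4^-1 -> 0 <= t ->
  (forall a w, a \in Nm -> w \in Nd ->
    \sum_i \sum_j a i 0 * x i j * w j 0 <= t) ->
  forall v, sqnorm (mulcol m d x v) <= 16 * t ^+ 2 * sqnorm v.
Proof.
move=> netm netd t0 hN.
have Nw w : w \in Nd -> sqnorm (mulcol m d x w) <= 4 * t ^+ 2.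
  move=> wN; apply: net_sqnorm_le netm t0 _ => a aN.
  apply: le_trans (hN _ _ aN wN); rewrite le_eqVlt; apply/orP; left; apply/eqP.
  apply: eq_bigr => i _; rewrite mxE mulr_suml.
  by apply: eq_bigr => j _; ring.
have improve B : (forall v, sqnorm (mulcol m d x v) <= B * sqnorm v) ->
    forall v, sqnorm (mulcol m d x v) <= (8 * t ^+ 2 + B / 2) * sqnorm v.
  move=> hB v; have [v0|v0] := eqVneq (sqnorm v) 0.
    by have := hB v; rewrite v0 !mulr0.
  have [r [u [r0 u1 vE v2]]] := unit_vector _ _ v0.
  have [w wN uw] : exists2 w, w \in Nd & sqnorm (u - w) <= 4^-1.
    by apply: netd; rewrite u1.
  rewrite vE mulcolZ !sqnormZ u1 mulr1 mulrC ler_wpM2r ?sqr_ge0//.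
  have -> : u = w + (u - w) by rewrite addrC subrK.
  rewrite mulcolD.
  apply: le_trans (sqnormD_le _ 2 2 _ _ _) _; first by move=> a b; have := sqr_ge0 (a - b); nra.
  have B0 : 0 <= B by have := hB u; rewrite u1 mulr1; apply: le_trans; exact: sqnorm_ge0.
  have := Nw _ wN; have := hB (u - w); nra.
(* The Frobenius norm starts the iteration; each round halves the excess over [16 * t ^+ 2]. *)
set B0 := \sum_i \sum_j x i j ^+ 2.
have B00 : 0 <= B0.
  by apply: sumr_ge0 => i _; apply: sumr_ge0 => j _; exact: sqr_ge0.
have iter k v : sqnorm (mulcol m d x v) <= (16 * t ^+ 2 + B0 * 2^-1 ^+ k) * sqnorm v.
  elim: k v => [v|k IH v].
    apply: le_trans (mulcol_frobenius _ _ _ _) _; rewrite expr0 mulr1.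
    by rewrite ler_wpM2r ?sqnorm_ge0// lerDr mulr_ge0// sqr_ge0.
  apply: le_trans (improve _ IH v) _.
  by rewrite le_eqVlt; apply/orP; left; apply/eqP; rewrite [_ ^+ k.+1]exprS; field.
move=> v; apply/ler_addgt0Pr => e e0.
have Bv : 0 <= B0 * sqnorm v by rewrite mulr_ge0// sqnorm_ge0.
pose k := (Num.truncn (B0 * sqnorm v / e)).+1.
have hk : B0 * sqnorm v < 2 ^+ k * e.
  have := truncnS_gt (B0 * sqnorm v / e); rewrite ltr_pdivrMr// => /lt_trans; apply.
  by rewrite ltr_pM2r// -natrX ltr_nat ltn_expl.
apply: le_trans (iter k v) _; rewrite mulrDl lerD2l mulrAC exprVn.
by rewrite ler_pdivrMr ?exprn_gt0// [leRHS]mulrC ltW.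
Qed.

End euclidean.

(** * Scalar inequalities *)

Section scalar_inequalities.
Context {R : realType}.
Implicit Types s t q r : R.

(** The derivative of the Huber penalty. *)
Definition huber_score t : R := if t < - 2 then - 2 else if 2 < t then 2 else t.

Lemma huber_score_sq_le t : huber_score t ^+ 2 <= 4.
Proof.
rewrite /huber_score; case: ltP => h1; first by nra.
case: ltP => h2; nra.
Qed.

Lemma huberE t :
  huber t = if t < - 2 then - 2 * t - 2 else if 2 < t then 2 * t - 2 else t ^+ 2 / 2.
Proof.
rewrite /huber; case: (leP 0 t) => t0.
  rewrite (ger0_norm t0) (_ : t < - 2 = false); last by apply/negP; lra.
  by case: leP.
rewrite (ltr0_norm t0) (_ : 2 < t = false); last by apply/negP; lra.
have -> : (t < - 2) = ~~ (- t <= 2) by rewrite -ltNge; apply/idP/idP; lra.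
by case: (- t <= 2) => //=; ring.
Qed.

Lemma huber_convex s t : 0 <= huber (s + t) - huber s - huber_score s * t.
Proof.
rewrite !huberE /huber_score.
have := sqr_ge0 (s + t + 2); have := sqr_ge0 (s + t - 2).
case: (ltP s (-2)) => h1; case: (ltP (s + t) (-2)) => h2.
- lra.
- by case: (ltP 2 (s + t)) => h3; nra.
- by case: (ltP 2 s) => h3; nra.
- by case: (ltP 2 (s + t)) => h3; case: (ltP 2 s) => h4; nra.
Qed.

(** The point [s] is at distance at least 1 from the kinks -2 and 2. Before a kink the excess over
    the tangent is t^2 / 2; beyond it the excess grows linearly with slope at least 1. *)
Lemma huber_growth s t : `|s| <= 1 ->
  Num.min (t ^+ 2) `|t| / 2 <= huber (s + t) - huber s - huber_score s * t.
Proof.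
rewrite ler_norml => /andP[s1 s2].
have h1 : (s < -2) = false by apply/negP; lra.
have h2 : (2 < s) = false by apply/negP; lra.
rewrite !huberE /huber_score h1 h2.
have m1 : Num.min (t ^+ 2) `|t| <= t ^+ 2 by rewrite ge_min lexx.
have m2 : Num.min (t ^+ 2) `|t| <= `|t| by rewrite ge_min lexx orbT.
move: (Num.min _ _) m1 m2 => m m1 m2.
case: (ltP (s + t) (-2)) => h3.
  have t0 : t < 0 by lra.
  rewrite (ltr0_norm t0) in m2.
  (* The excess is -t (2 + s) - (2 + s)^2 / 2. This product replaces -t by its lower bound 2 + s,
     and the next one settles the remainder. *)
  have : 0 <= (- t - (2 + s)) * (s + 3 / 2) by rewrite mulr_ge0//; lra.
  have : 0 <= (2 + s) * (1 + s) by rewrite mulr_ge0//; lra.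
  by lra.
case: (ltP 2 (s + t)) => h4; last by lra.
have t0 : 0 < t by lra.
rewrite (gtr0_norm t0) in m2.
have : 0 <= (t - (2 - s)) * (3 / 2 - s) by rewrite mulr_ge0//; lra.
have : 0 <= (2 - s) * (1 - s) by rewrite mulr_ge0//; lra.
by lra.
Qed.

Definition capped_sq q : R := Num.min (q ^+ 2) 1.

Lemma capped_sq_ge0 q : 0 <= capped_sq q.
Proof. by rewrite /capped_sq le_min sqr_ge0/=. Qed.

Lemma capped_sq_perturb q r : capped_sq q <= 2 * capped_sq r + 2 * (q - r) ^+ 2.
Proof.
have q2 := sqr_ge0 (q - r).
have q1 : capped_sq q <= 1 by rewrite ge_min lexx orbT.
have qq : capped_sq q <= q ^+ 2 by rewrite ge_min lexx.
rewrite {2}/capped_sq; case: (leP (r ^+ 2) 1) => r1; last by nra.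
by have := sqr_ge0 (q - 2 * r); nra.
Qed.

(** The factor is min(r^2, r), one entry for each branch of the growth bound. This reduces growth
    along any vector to growth along its unit direction. *)
Lemma capped_sq_scale r q : 0 <= r ->
  r * Num.min r 1 * capped_sq q <= Num.min ((r * q) ^+ 2) `|r * q|.
Proof.
move=> r0; rewrite normrM (ger0_norm r0) exprMn.
have c0 := capped_sq_ge0 q.
have c1 : capped_sq q <= q ^+ 2 by rewrite ge_min lexx.
have m0 : 0 <= Num.min r 1 by rewrite le_min r0/=.
have m1 : Num.min r 1 <= 1 by rewrite ge_min lexx orbT.
have mr : Num.min r 1 <= r by rewrite ge_min lexx.
have c2 : capped_sq q <= `|q|.
  rewrite /capped_sq; have [q1|q1] := leP `|q| 1.
    rewrite ge_min; apply/orP; left.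
    by rewrite -real_normK ?num_real// expr2 ler_piMl.
  by rewrite ge_min (ltW q1) orbT.
rewrite le_min; apply/andP; split.
  rewrite expr2 -!mulrA ler_wpM2l//.
  by apply: ler_pM.
rewrite -mulrA ler_wpM2l//; apply: le_trans c2.
by rewrite ler_piMl.
Qed.

(** Write e as the eighth power of e^(1/8), which is at most 1 / (1 - 1/8). The constant is just
    small enough to give e^2 <= 17/2 later. *)
Lemma expR1_lt : expR 1 < 583 / 200 :> R.
Proof.
have h := expR_ge1Dx (- 8^-1 : R).
have e0 := expR_gt0 (8^-1 : R).
have e8 : expR (8^-1 : R) <= 8 / 7.
  have : expR (- 8^-1) * expR (8^-1) = 1 :> R by rewrite -expRD addNr expR0.
  move: h e0; set x := expR (- _); set y := expR _ => h y0 xy.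
  have : (7 / 8) * y <= x * y by rewrite ler_pM2r//; lra.
  by rewrite xy; lra.
have -> : 1 = 8%:R * 8^-1 :> R by rewrite divff.
rewrite expRM_natl; apply: (@le_lt_trans _ _ ((8 / 7) ^+ 8)); last lra.
by rewrite lerXn2r ?nnegrE.
Qed.

(* With h = 1/100, the exponential polynomial sum_a test_coef a e^(test_exp a q)
   is 1 - h^2 ((e^q - 1)^2 - h^2 e^(4 q) / 2), and the subtracted term is at
   most min (q^2, 1) / 2, while its Gaussian mean is bounded below. *)
Definition test_coef (a : 'I_4) : R :=
  [:: 1 - 100^-1 ^+ 2; 2 * 100^-1 ^+ 2; - 100^-1 ^+ 2; 100^-1 ^+ 4 / 2]`_a.

Definition test_exp (a : 'I_4) : R := [:: 0; 1; 2; 4]`_a.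

Lemma test_sumE (F : R -> R) : \sum_a test_coef a * F (test_exp a) =
  (1 - 100^-1 ^+ 2) * F 0 + 2 * 100^-1 ^+ 2 * F 1 - 100^-1 ^+ 2 * F 2
  + 100^-1 ^+ 4 / 2 * F 4.
Proof. by rewrite !big_ord_recl big_ord0 /test_coef /test_exp/=; ring. Qed.

Lemma expR_capped_sq_le q :
  expR (- capped_sq q) <= \sum_a test_coef a * expR (test_exp a * q).
Proof.
rewrite (test_sumE (fun x => expR (x * q))) mul0r mul1r expR0.
have e2 : expR (2 * q) = expR q ^+ 2 by rewrite expRM_natl.
have e4 : expR (4 * q) = expR q ^+ 4 by rewrite expRM_natl.
rewrite e2 e4.
have y0 := capped_sq_ge0 q.
have y1 : capped_sq q <= 1 by rewrite ge_min lexx orbT.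
(* On [0, 1], e^(-y) <= 1 / (1 + y) <= 1 - y / 2. *)
have hy : expR (- capped_sq q) <= 1 - capped_sq q / 2.
  rewrite expRN; have := expR_ge1Dx (capped_sq q).
  move: (capped_sq q) y0 y1 (expR _) => y y0 y1 z hz.
  have z0 : 0 < z by lra.
  by rewrite -(ler_pM2r z0) mulVf ?gt_eqF//; nra.
apply: le_trans hy _.
have x0 := expR_gt0 q.
suff : 100^-1 ^+ 2 * ((expR q - 1) ^+ 2 - 100^-1 ^+ 2 / 2 * expR q ^+ 4) <=
    capped_sq q / 2.
  by move: (expR q) => x; lra.
suff : (expR q - 1) ^+ 2 - 100^-1 ^+ 2 / 2 * expR q ^+ 4 <=
    50 * 100 * capped_sq q.
  by move: (_ - _) => x; lra.
(* For |q| <= 1 the estimate |e^q - 1| <= 3 |q| suffices; for larger |q| the quartic term keeps the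
   left side bounded. *)
rewrite /capped_sq; case: (leP (q ^+ 2) 1) => hq.
  suff h : `|expR q - 1| <= 3 * `|q|.
    have : (expR q - 1) ^+ 2 <= 9 * q ^+ 2.
      rewrite -[X in X <= _]real_normK ?num_real//.
      rewrite -[q ^+ 2]real_normK ?num_real//.
      by have := normr_ge0 (expR q - 1); nra.
    have : 0 <= expR q ^+ 4 by rewrite exprn_ge0// ltW.
    by have := sqr_ge0 q; move: (expR q ^+ 4) ((expR q - 1) ^+ 2) (q ^+ 2) => a b c; lra.
  have [q0|q0] := leP 0 q.
    rewrite (ger0_norm q0) ger0_norm; last by rewrite subr_ge0 -expR0 ler_expR.
    have q1 : q <= 1 by nra.
    have x3 : expR q <= 3.
      have e3 : expR 1 <= 3 :> R by have := expR1_lt; lra.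
      by apply: le_trans e3; rewrite ler_expR.
    have := expR_ge1Dx (- q).
    have : expR (- q) * expR q = 1 by rewrite -expRD addNr expR0.
    by move: x0 x3; move: (expR q) (expR (- q)) => x z; nra.
  rewrite (ltr0_norm q0) ler0_norm; last first.
    by rewrite subr_le0 -expR0 ler_expR ltW.
  by have := expR_ge1Dx q; lra.
rewrite mulr1; move: (expR q) x0 => x x0.
(* The square below bounds the left side by 5001 - 2 x, hence the threshold 1/2; for smaller [x]
   already (x - 1)^2 <= 1. *)
have [x1|x1] := leP (2^-1) x.
  have := sqr_ge0 (x ^+ 2 / 100 - 100); rewrite sqrrB exprMn -exprM => h.
  by lra.
have : 0 <= x ^+ 4 by rewrite exprn_ge0// ltW.
by move: (x ^+ 4) => z; nra.
Qed.

Lemma test_mean_itv s : 2^-1 <= s -> s <= 1 ->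
  0 <= \sum_a test_coef a * expR (test_exp a ^+ 2 * s / 2) <=
    expR (- (100^-1 ^+ 2 / 2)).
Proof.
move=> s1 s2.
rewrite (test_sumE (fun x => expR (x ^+ 2 * s / 2))).
rewrite expr0n/= mul0r mul0r expR0 expr1n mul1r.
(* With h = 1/100 the sum is 1 - h^2 (1 - 2 y + y^4 - h^2 y^16 / 2). The bounds on [y] keep the
   bracket above 1/2, whence the exponent h^2 / 2. *)
set y := expR (s / 2).
have -> : expR (2 ^+ 2 * s / 2) = y ^+ 4.
  by rewrite -expRM_natl; congr expR; field.
have -> : expR (4 ^+ 2 * s / 2) = y ^+ 16.
  by rewrite -expRM_natl; congr expR; field.
have y1 : 5 / 4 <= y by apply: le_trans (expR_ge1Dx _); lra.
have y4 : y ^+ 4 <= 17 / 2.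
  have -> : y ^+ 4 = expR (2 * s) by rewrite -expRM_natl; congr expR; field.
  apply: (@le_trans _ _ (expR 2)); first by rewrite ler_expR; lra.
  have -> : 2 = 2%:R * 1 :> R by rewrite mulr1.
  by rewrite expRM_natl; have := expR1_lt; have := expR_gt0 (1 : R); nra.
have y16 : y ^+ 16 <= (17 / 2) ^+ 4.
  rewrite (_ : y ^+ 16 = (y ^+ 4) ^+ 4); last by rewrite -exprM.
  by rewrite lerXn2r ?nnegrE ?exprn_ge0//; lra.
have y2 : y <= 7 / 4.
  rewrite leNgt; apply/negP => yl.
  have : (7 / 4) ^+ 4 < y ^+ 4 by rewrite ltrXn2r//; lra.
  by lra.
have y3 : 125 / 64 <= y ^+ 3.
  have -> : 125 / 64 = (5 / 4) ^+ 3 :> R by field.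
  by rewrite lerXn2r ?nnegrE//; lra.
have y4' : y * (125 / 64) <= y ^+ 4 by rewrite exprS ler_pM2l//; lra.
have z0 : 0 <= y ^+ 16 by rewrite exprn_ge0//; lra.
apply/andP; split; last apply: le_trans (expR_ge1Dx _).
all: move: (y ^+ 16) (y ^+ 4) y4' y16 y4 z0 => z w yw zl wl z0; lra.
Qed.

End scalar_inequalities.

(** * Localization of the minimizer *)

Section localization.
Context {R : realType}.

Lemma sum_injective_le (m n : nat) (g : 'I_m -> 'I_n) (F : 'I_n -> R) :
  injective g -> (forall i, 0 <= F i) -> \sum_k F (g k) <= \sum_i F i.
Proof.
move=> ginj F0; pose A := finset.imset g (mem 'I_m).
have -> : \sum_k F (g k) = \sum_(i in A) F i.
  by rewrite big_imset//= => k1 k2 _ _ /ginj.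
rewrite [leRHS](bigID (mem A))/= lerDl.
by apply: sumr_ge0 => i _; exact: F0.
Qed.

(** Replacing [v] by a nearby net point costs the squared norm of the image of the difference, which
    the operator bound limits to [B * e]. *)
Lemma capped_sq_net_transfer (m d : nat) (x : 'I_m -> 'I_d -> R)
  (N : seq 'cV[R]_d) (e B S : R) :
  is_net d N e -> e <= 100^-1 ->
  (forall v, sqnorm (mulcol m d x v) <= B * sqnorm v) ->
  (forall w, w \in N -> 2^-1 <= sqnorm w ->
    S <= \sum_k capped_sq (mulcol m d x w k 0)) ->
  forall v, sqnorm v = 1 ->
    S <= 2 * (\sum_k capped_sq (mulcol m d x v k 0)) + 2 * (B * e).
Proof.
move=> Nnet e1 opB lowS v v1.
have [w wN vw] : exists2 w, w \in N & sqnorm (v - w) <= e.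
  by apply: Nnet; rewrite v1.
have w2 : 2^-1 <= sqnorm w.
  (* These weights give 1 <= 5/4 |w|^2 + 5/100, so the net point is long enough for [lowS]. *)
  have := sqnormD_le d (5 / 4) 5 w (v - w) _.
  rewrite [w + _]addrC subrK v1 => h.
  have : 1 <= 5 / 4 * sqnorm w + 5 * sqnorm (v - w).
    by apply: h => a b; have := sqr_ge0 (a / 2 - 2 * b); nra.
  by lra.
have B0 : 0 <= B.
  by have := opB v; rewrite v1 mulr1; apply: le_trans; exact: sqnorm_ge0.
apply: le_trans (lowS _ wN w2) _.
apply: (@le_trans _ _ (2 * (\sum_k capped_sq (mulcol m d x v k 0))
    + 2 * sqnorm (mulcol m d x (v - w)))).
  rewrite /sqnorm !mulr_sumr -big_split/=; apply: ler_sum => k _.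
  have -> : mulcol m d x (v - w) k 0 = - (mulcol m d x w k 0 - mulcol m d x v k 0).
    have -> : mulcol m d x v k 0 = mulcol m d x (v - w) k 0 + mulcol m d x w k 0.
      transitivity ((mulcol m d x (v - w) + mulcol m d x w) k 0).
        by rewrite -mulcolD subrK.
      by rewrite [LHS]mxE.
    by ring.
  by rewrite sqrrN; exact: capped_sq_perturb.
rewrite lerD2l ler_pM2l//; apply: le_trans (opB _) _.
by rewrite ler_wpM2l.
Qed.

(* Convexity bounds the increase of the loss along u from below by the linear
   term at 0 plus the growth of the coordinates in the range of g; the minimum
   of |u| and 1 accounts for the linear branch of the Huber penalty. *)
Lemma huber_localization (n d m : nat) (x : 'I_n -> 'I_d -> R)
  (eta : 'cV[R]_n) (g : 'I_m -> 'I_n) (u : 'cV[R]_d) (G c : R) :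
  injective g -> (forall k, `|eta (g k) 0| <= 1) ->
  \sum_i huber (mulcol n d x u i 0 - eta i 0) <= \sum_i huber (- eta i 0) ->
  sqnorm (\col_j \sum_i huber_score (- eta i 0) * x i j) <= G ->
  (forall v, sqnorm v = 1 -> c <= \sum_k capped_sq (mulcol n d x v (g k) 0)) ->
  0 <= c -> G < (c / 2) ^+ 2 -> sqnorm u * (c / 2) ^+ 2 <= G.
Proof.
move=> ginj eta1 lossu gradG growc c0 Gc.
set z : 'cV_d := \col_j _ in gradG.
have G0 : 0 <= G := le_trans (sqnorm_ge0 _ z) gradG.
have [->|u0] := eqVneq (sqnorm u) 0; first by rewrite mul0r.
have [r [v [r0 v1 uE u2]]] := unit_vector _ _ u0.
pose F i := huber (- eta i 0 + mulcol n d x u i 0) - huber (- eta i 0)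
  - huber_score (- eta i 0) * mulcol n d x u i 0.
have F0 i : 0 <= F i by exact: huber_convex.
(* The loss at [u] does not exceed the loss at 0, so the total excess over the tangent is at most
   minus the linear term. *)
have upper : \sum_i F i <= - dot d z u.
  rewrite /F !sumrB.
  have -> : \sum_i huber_score (- eta i 0) * mulcol n d x u i 0 = dot d z u.
    rewrite /dot; under eq_bigr do rewrite mxE mulr_sumr.
    rewrite exchange_big/=; apply: eq_bigr => j _.
    by rewrite mxE mulr_suml; apply: eq_bigr => i _; ring.
  rewrite -[leRHS]add0r lerB// subr_le0.
  by under eq_bigr do rewrite addrC.
have lower : r * Num.min r 1 / 2 * c <= \sum_i F i.
  apply: le_trans (sum_injective_le _ _ g F ginj F0).
  have m0 : 0 <= Num.min r 1 by rewrite le_min ltW//=.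
  apply: le_trans (_ : r * Num.min r 1 / 2 *
      (\sum_k capped_sq (mulcol n d x v (g k) 0)) <= _).
    by rewrite ler_wpM2l ?growc// mulr_ge0// mulr_ge0// ltW.
  rewrite mulr_sumr; apply: ler_sum => k _.
  apply: le_trans (_ : Num.min (mulcol n d x u (g k) 0 ^+ 2)
      `|mulcol n d x u (g k) 0| / 2 <= _); last first.
    by apply: huber_growth; rewrite normrN.
  have -> : mulcol n d x u (g k) 0 = r * mulcol n d x v (g k) 0.
    by rewrite uE mulcolZ [LHS]mxE.
  rewrite mulrAC ler_pM2r//.
  by apply: capped_sq_scale; exact: ltW.
have zu : dot d z u ^+ 2 <= G * r ^+ 2.
  apply: le_trans (dot_cauchy_schwarz _ _ _) _.
  by rewrite u2 ler_wpM2r// sqr_ge0.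
have : (r * (Num.min r 1 * (c / 2))) ^+ 2 <= G * r ^+ 2.
  have m0 : 0 <= r * (Num.min r 1 * (c / 2)).
    by rewrite !mulr_ge0// ?le_min ltW//=.
  have mu : r * (Num.min r 1 * (c / 2)) <= - dot d z u.
    apply: le_trans upper; apply: le_trans lower.
    by rewrite le_eqVlt; apply/orP; left; apply/eqP; ring.
  apply: le_trans zu; rewrite -[leRHS]sqrrN lerXn2r ?nnegrE//.
  exact: le_trans mu.
rewrite exprMn mulrC ler_pM2r ?exprn_gt0//.
(* For r > 1 the inequality would read (c / 2)^2 <= G, against [Gc]; so the quadratic regime
   holds. *)
rewrite u2; case: (leP r 1) => r1; first by rewrite exprMn.
by rewrite mul1r => /(lt_le_trans Gc); rewrite ltxx.
Qed.

End localization.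

(** * High-probability events *)

Section events.
Context {R : realType} {dT : measure_display} {T : measurableType dT}.
Variables (P : probability T R) (d : nat).
Hypothesis d1 : (1 <= d)%N.

Lemma sum_seq_le_size (I : eqType) (N : seq I) (Q : pred I) (F : I -> R) (b : R) :
  0 <= b -> (forall w, w \in N -> Q w -> F w <= b) ->
  \sum_(w <- N | Q w) F w <= (size N)%:R * b.
Proof.
move=> b0 Fb; rewrite big_seq_cond.
apply: (@le_trans _ _ (\sum_(w <- N | (w \in N) && Q w) b)).
  by apply: ler_sum => w /andP[]; exact: Fb.
rewrite -big_seq_cond big_mkcond/=.
apply: (@le_trans _ _ (\sum_(w <- N) b)).
  by apply: ler_sum => w _; case: (Q w).
by rewrite big_const_seq count_predT iter_addr_0 mulr_natl.
Qed.

Lemma sum_seq_lt1 (I : eqType) (N : seq I) (Q : pred I) (F : I -> R) w :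
  (forall w, 0 <= F w) -> w \in N -> Q w -> \sum_(w <- N | Q w) F w < 1 -> F w < 1.
Proof.
move=> F0 wN Qw; apply: le_lt_trans.
rewrite (big_rem w)//= Qw lerDl.
by apply: sumr_ge0 => v _; exact: F0.
Qed.

(** Chernoff and a union bound over a net of size at most e^(6 d). With l s = D each term has
    exponent at most 2 D - 9 D, and 6 D - 7 D = -D remains. [Z] sums the exponentials, so Z < 1
    bounds every one of them by 1. *)
Lemma gradient_event (n : nat) (X : 'I_n -> 'I_d -> T -> R) (phi : 'I_n -> R)
  (D : R) : has_gaussian_mgf P d n X -> (1 <= n)%N ->
  (forall i, phi i ^+ 2 <= 4) -> d%:R <= D ->
  exists Z z, [/\ has_mean P Z z, forall t, 0 <= Z t, z <= expR (- D) &
    forall t, Z t < 1 ->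
      sqnorm (\col_j \sum_i phi i * X i j t) <= 4 * 81 * (n%:R * D)].
Proof.
move=> gX n1 phi4 dD.
have d0 : 1 <= d%:R :> R by rewrite ler1n.
have n0 : 1 <= n%:R :> R by rewrite ler1n.
have D0 : 0 < D by lra.
have [N [sN N1 Nnet]] := ball_net d (4^-1 : R) d1 ltac:(lra).
pose l := Num.sqrt (D / n%:R); pose s := Num.sqrt (n%:R * D).
have s0 : 0 <= s by exact: sqrtr_ge0.
have l2 : l ^+ 2 = D / n%:R by rewrite sqr_sqrtr// divr_ge0//; lra.
have s2 : s ^+ 2 = n%:R * D by rewrite sqr_sqrtr// mulr_ge0//; lra.
have l0 : 0 < l by rewrite sqrtr_gt0 divr_gt0//; lra.
have ls : l * s = D.
  rewrite /l /s -sqrtrM ?divr_ge0//; try lra.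
  rewrite (_ : D / n%:R * (n%:R * D) = D ^+ 2); last by field; lra.
  by rewrite sqrtr_sqr gtr0_norm.
pose a : 'cV[R]_n := \col_i phi i.
have a4 : sqnorm a <= 4 * n%:R.
  rewrite /sqnorm -[n in leRHS]card_ord mulr_natr -sumr_const.
  by apply: ler_sum => i _; rewrite mxE.
exists (fun t => \sum_(w <- N) expR
  (l * (\sum_i \sum_j a i 0 * X i j t * w j 0) - l * (9 * s))).
exists (\sum_(w <- N) expR (l ^+ 2 * (sqnorm a * sqnorm w) / 2 - l * (9 * s))).
split.
- by apply: has_mean_sum => w; exact: bilinear_mgf.
- by move=> t; apply: sumr_ge0 => w _; exact: expR_ge0.
- apply: le_trans (sum_seq_le_size _ _ _ _ (expR (- (7 * D))) _ _) _.
  + exact: expR_ge0.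
  + move=> w wN _; rewrite ler_expR l2 [l * _]mulrCA ls.
    have : D / n%:R * (sqnorm a * sqnorm w) <= D / n%:R * (4 * n%:R).
      rewrite ler_wpM2l ?divr_ge0//; try lra.
      rewrite -[leRHS]mulr1; apply: ler_pM => //; [exact: sqnorm_ge0..|].
      exact: N1.
    rewrite (_ : D / n%:R * (4 * n%:R) = 4 * D); last by field; lra.
    by lra.
  + apply: (@le_trans _ _ (expR ((2 + 4^-1^-1) * d%:R) * expR (- (7 * D)))).
      by rewrite ler_wpM2r ?expR_ge0.
    by rewrite -expRD ler_expR invrK; lra.
- move=> t Zt.
  have -> : 4 * 81 * (n%:R * D) = 4 * (9 * s) ^+ 2 by rewrite exprMn s2; ring.
  apply: (net_sqnorm_le _ N) => //; first by rewrite mulr_ge0.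
  move=> w wN; have := sum_seq_lt1 _ _ _ _ _ _ wN isT Zt.
  move=> /(_ (fun w => expR_ge0 _)); rewrite expR_lt1 -mulrBr pmulr_rlt0//.
  rewrite subr_lt0 => /ltW; apply: le_trans.
  rewrite le_eqVlt; apply/orP; left; apply/eqP.
  rewrite exchange_big/=; apply: eq_bigr => j _; rewrite mxE mulr_suml.
  by apply: eq_bigr => i _; rewrite mxE.
Qed.

(** The union runs over pairs from nets of sizes at most e^(6 m) and e^(6 d). With l^2 = m each term
    is at most e^(-13 m), and D <= m leaves e^(-D). *)
Lemma operator_event (m : nat) (X : 'I_m -> 'I_d -> T -> R) (D : R) :
  has_gaussian_mgf P d m X -> (1 <= m)%N -> d%:R <= D -> D <= m%:R ->
  exists Z z, [/\ has_mean P Z z, forall t, 0 <= Z t, z <= expR (- D) &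
    forall t, Z t < 1 -> forall v,
      sqnorm (mulcol m d (fun i j => X i j t) v) <=
      16 * 196 * m%:R * sqnorm v].
Proof.
move=> gX m1 dD Dm.
have d0 : 1 <= d%:R :> R by rewrite ler1n.
have m0 : 1 <= m%:R :> R by rewrite ler1n.
have [Nd [sNd Nd1 Ndnet]] := ball_net d (4^-1 : R) d1 ltac:(lra).
have [Nm [sNm Nm1 Nmnet]] := ball_net m (4^-1 : R) m1 ltac:(lra).
pose l : R := Num.sqrt m%:R.
have l2 : l ^+ 2 = m%:R by rewrite sqr_sqrtr//; lra.
have l0 : 0 < l by rewrite sqrtr_gt0; lra.
pose F (t : T) (a : 'cV[R]_m) (w : 'cV[R]_d) := expR
  (l * (\sum_i \sum_j a i 0 * X i j t * w j 0) - l * (14 * l)).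
have F0 t a w : 0 <= F t a w by exact: expR_ge0.
exists (fun t => \sum_(a <- Nm) \sum_(w <- Nd) F t a w).
exists (\sum_(a <- Nm) \sum_(w <- Nd)
  expR (l ^+ 2 * (sqnorm a * sqnorm w) / 2 - l * (14 * l))).
split.
- apply: has_mean_sum => a; apply: has_mean_sum => w; exact: bilinear_mgf.
- by move=> t; apply: sumr_ge0 => a _; apply: sumr_ge0 => w _.
- have b0 : 0 <= (size Nd)%:R * expR (- (13 * m%:R)) :> R.
    by rewrite mulr_ge0 ?expR_ge0.
  apply: le_trans (sum_seq_le_size _ _ _ _
    ((size Nd)%:R * expR (- (13 * m%:R))) b0 _) _.
    move=> a aN _; apply: sum_seq_le_size; first exact: expR_ge0.
    move=> w wN _; rewrite ler_expR [l * (14 * l)]mulrCA -expr2 l2.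
    have : m%:R * (sqnorm a * sqnorm w) <= m%:R * 1.
      rewrite ler_wpM2l//.
      rewrite -[leRHS]mulr1; apply: ler_pM => //; [exact: sqnorm_ge0..| |].
        exact: Nm1.
      exact: Nd1.
    by lra.
  apply: (@le_trans _ _ (expR ((2 + 4^-1^-1) * m%:R) *
     (expR ((2 + 4^-1^-1) * d%:R) * expR (- (13 * m%:R))))).
    apply: ler_pM => //.
    by rewrite ler_wpM2r ?expR_ge0.
  by rewrite -!expRD ler_expR invrK; lra.
- move=> t Zt v.
  have -> : 16 * 196 * m%:R = 16 * (14 * l) ^+ 2 by rewrite exprMn l2; ring.
  apply: net_operator_norm Nmnet Ndnet _ _ v; first by rewrite mulr_ge0// ltW.
  move=> a w aN wN.
  have := sum_seq_lt1 _ _ _ _ _ _ aN isT Zt.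
  move=> /(_ (fun a => sumr_ge0 _ (fun w _ => F0 t a w))).
  move=> /(sum_seq_lt1 _ _ _ _ _ (F0 t a) wN isT).
  by rewrite expR_lt1 -mulrBr pmulr_rlt0// subr_lt0 => /ltW.
Qed.

(** A lower-tail Chernoff bound. The product over rows has mean at most e^(-kap m), half of which
    pays for the level [kap * m%:R / 2]; the other half pays for the net and for e^(-D). Short net
    points are excluded because [test_mean_itv] asks for squared norm at least 1/2. *)
Lemma small_ball_event (m : nat) (X : 'I_m -> 'I_d -> T -> R) (D e : R) :
  let kap := 100^-1 ^+ 2 / 2 in
  has_gaussian_mgf P d m X -> d%:R <= D -> 0 < e ->
  (3 + e^-1) * D <= kap * m%:R / 2 ->
  exists N Z z, [/\ is_net d N e, has_mean P Z z, forall t, 0 <= Z t,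
    z <= expR (- D) &
    forall t, Z t < 1 -> forall w, w \in N -> 2^-1 <= sqnorm w ->
      kap * m%:R / 2 <=
      \sum_k capped_sq (mulcol m d (fun i j => X i j t) w k 0)].
Proof.
move=> kap gX dD e0 De.
have [N [sN N1 Nnet]] := ball_net d e d1 e0.
pose G (t : T) (w : 'cV[R]_d) k :=
  \sum_a test_coef a * expR (test_exp a * \sum_j X k j t * w j 0).
have Gge t w k : expR (- capped_sq (mulcol m d (fun i j => X i j t) w k 0)) <= G t w k.
  by rewrite mxE; exact: expR_capped_sq_le.
have G0 t w k : 0 <= G t w k := le_trans (expR_ge0 _) (Gge t w k).
have F0 t w : 0 <= expR (kap * m%:R / 2) * \prod_k G t w k.
  by rewrite mulr_ge0 ?expR_ge0//; apply: prodr_ge0 => k _.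
exists N, (fun t => \sum_(w <- N | 2^-1 <= sqnorm w)
  expR (kap * m%:R / 2) * \prod_k G t w k).
exists (\sum_(w <- N | 2^-1 <= sqnorm w) expR (kap * m%:R / 2) *
  (\sum_a test_coef a * expR (test_exp a ^+ 2 * sqnorm w / 2)) ^+ m).
split => //.
- by apply: has_mean_sum => w; apply: has_meanZ; exact: exp_poly_rows_mean.
- by move=> t; apply: sumr_ge0 => w _.
- apply: le_trans (sum_seq_le_size _ _ _ _ (expR (- (kap * m%:R / 2))) _ _) _.
  + exact: expR_ge0.
  + move=> w wN w2.
    apply: (@le_trans _ _ (expR (kap * m%:R / 2) * expR (- kap) ^+ m)).
      rewrite ler_wpM2l ?expR_ge0//.
      have /andP[h0 h1] := test_mean_itv _ w2 (N1 _ wN).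
      by rewrite lerXn2r ?nnegrE ?expR_ge0.
    by rewrite -expRM_natl -expRD ler_expR; lra.
  + apply: (@le_trans _ _ (expR ((2 + e^-1) * d%:R) * expR (- (kap * m%:R / 2)))).
      by rewrite ler_wpM2r ?expR_ge0.
    rewrite -expRD ler_expR.
    have ei : 0 < e^-1 by rewrite invr_gt0.
    by nra.
- move=> t Zt w wN w2.
  have := sum_seq_lt1 _ _ _ _ _ (F0 t) wN w2 Zt.
  have : expR (- \sum_k capped_sq (mulcol m d (fun i j => X i j t) w k 0)) <=
      \prod_k G t w k.
    rewrite -sumrN expR_sum; apply: ler_prod => k _.
    by rewrite expR_ge0/=.
  move=> /(ler_wpM2l (expR_ge0 (kap * m%:R / 2))) h /(le_lt_trans h).
  by rewrite -expRD expR_lt1 subr_lt0 => /ltW.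
Qed.

End events.

(** * Choice of the constants and combination of the three events *)

Theorem mainTheorem1 (R : realType) :
  exists C C' : R, 0 < C /\ 0 < C' /\
  forall (n d : nat) (alpha : R) (eta : 'cV[R]_n)
    (dT : measure_display) (T : measurableType dT) (P : probability T R)
    (X : 'I_n -> 'I_d -> T -> R) (delta : R),
    (1 <= n)%N -> (1 <= d)%N ->
    0 < alpha -> alpha <= 1 ->
    alpha * n%:R <= #|[set i : 'I_n | `|eta i 0| <= 1]|%:R ->
    (forall i j, std_gaussian P (X i j)) ->
    mutually_independent P X ->
    0 < delta -> delta < 1 ->
    C * ((d%:R + ln (2 / delta)) / alpha ^+ 2) <= n%:R ->
    exists E : set T, measurable E /\ ((1 - delta)%:E <= P E)%E /\
      forall w, E w ->
        forall (bstar bhat : 'cV[R]_d),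
          is_huber_minimizer (data_matrix X w)
            (data_matrix X w *m bstar + eta) bhat ->
          sqnorm (bstar - bhat) <=
            C' * ((d%:R + ln (2 / delta)) / (alpha ^+ 2 * n%:R)).
Proof.
pose kap : R := 100^-1 ^+ 2 / 2.
have kap0 : 0 < kap by rewrite /kap; lra.
have kap1 : kap <= 1 by rewrite /kap; lra.
(* The three conditions yield, in order, D <= m, the budget of [small_ball_event], and the strict
   inequality required by [huber_localization]. *)
have [K [K1 Kq KG]] : exists K : R,
    [/\ 1 <= K, 2 * (3 + 128 * 196) <= K & 256 * (4 * 81) < K].
  by exists (83 * 1000); split; lra.
have K0 : 0 < K by lra.
pose C : R := K / kap ^+ 2.
have C0 : 0 < C by rewrite divr_gt0 ?exprn_gt0.
have CK : C * kap ^+ 2 = K by rewrite divfK// expf_neq0// gt_eqF.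
have kC : K <= kap * C.
  by rewrite -CK expr2 mulrA [leRHS]mulrC ler_piMr// mulr_ge0// ltW.
have C1 : K <= C by apply: le_trans kC _; rewrite ler_piMl// ltW.
exists C, C; split=> //; split=> //.
move=> n d al eta dT T P X delta n1 d1 al0 al1 cardS gX iX de0 de1 nC.
set D := d%:R + ln (2 / delta) in nC *.
have d0 : 1 <= d%:R :> R by rewrite ler1n.
have n0 : 0 < n%:R :> R by rewrite ltr0n.
have L0 : 0 <= ln (2 / delta) by rewrite ln_ge0// ler_pdivlMr//; lra.
have D1 : 1 <= D by rewrite /D; lra.
have dD : d%:R <= D by rewrite /D; lra.
(* Each of the three events fails with probability at most e^(-D) = e^(-d) delta / 2 <= delta /
   4. *)
have expD : 3 * expR (- D) <= delta.
  rewrite /D opprD expRD -lnV ?posrE ?divr_gt0// invf_div lnK ?posrE ?divr_gt0//.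
  have : expR (- d%:R) <= 2^-1 :> R.
    rewrite expRN lef_pV2 ?posrE ?expR_gt0//.
    by apply: le_trans (@expR1_ge2 R) _; rewrite ler_expR.
  have := expR_gt0 (- d%:R : R); nra.
move: cardS; set m := #|_| => cardS.
pose g (k : 'I_m) : 'I_n := enum_val k.
have ginj : injective g by exact: enum_val_inj.
have eta1 k : `|eta (g k) 0| <= 1.
  by have /set_mem := enum_valP k.
have CDn : C * D <= al ^+ 2 * n%:R.
  by move: nC; rewrite mulrA ler_pdivrMr ?exprn_gt0// [n%:R * _]mulrC.
have CDm : C * D <= m%:R.
  apply: le_trans cardS; apply: le_trans CDn _.
  by rewrite ler_wpM2r// expr2 ler_piMr// ltW.
have Dm : D <= m%:R by apply: le_trans CDm; rewrite ler_peMl//; lra.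
have m1 : (1 <= m)%N by rewrite -(ler1n R); apply: le_trans Dm.
have CDm2 : n%:R * (C * D) <= m%:R ^+ 2.
  apply: (@le_trans _ _ (n%:R * (al ^+ 2 * n%:R))); first by rewrite ler_wpM2l// ltW.
  rewrite (_ : _ * _ = (al * n%:R) ^+ 2); last by ring.
  by rewrite lerXn2r ?nnegrE// mulr_ge0// ltW.
have mgfX := gaussian_matrix_mgf P d n X gX iX.
have mgfg := gaussian_mgf_rows P d n m X g ginj mgfX.
(* The net radius makes the operator error [16 * 196 * m%:R * e] equal to kap m / 8, a quarter of
   the small-ball level. *)
pose e := kap / (128 * 196).
have e0 : 0 < e by rewrite /e; lra.
have e1 : e <= 100^-1 by rewrite /e; lra.
have eD : (3 + e^-1) * D <= kap * m%:R / 2.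
  have ei : e^-1 * kap = 128 * 196 by rewrite /e invf_div divfK// gt_eqF.
  have kCm : kap * (C * D) <= kap * m%:R by rewrite ler_pM2l.
  have : (3 + e^-1) * D <= kap * C * D / 2.
    rewrite mulrAC ler_pM2r; last by lra.
    rewrite -(ler_pM2l kap0).
    have -> : kap * (kap * C / 2) = K / 2 by rewrite -CK; ring.
    have -> : kap * (3 + e^-1) = 3 * kap + 128 * 196 by rewrite -ei; ring.
    by lra.
  by lra.
have [Z1 [z1 [mZ1 Z10 z1D hZ1]]] := gradient_event P d d1 n X
  (fun i => huber_score (- eta i 0)) D mgfX n1
  (fun i => huber_score_sq_le _) dD.
have [Z2 [z2 [mZ2 Z20 z2D hZ2]]] := operator_event P d d1 m _ D mgfg m1 dD Dm.
have [N [Z3 [z3 [Nnet mZ3 Z30 z3D hZ3]]]] := small_ball_event P d d1 m _ D e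
  mgfg dD e0 eD.
have mZ := has_meanD P _ _ _ _ (has_meanD P _ _ _ _ mZ1 mZ2) mZ3.
have Z0 t : 0 <= Z1 t + Z2 t + Z3 t by rewrite !addr_ge0.
have [mE PE] := has_mean_markov P _ _ mZ Z0.
(* The event is fixed before [bstar], which gives simultaneity; everything after it is
   deterministic. *)
exists [set t | Z1 t + Z2 t + Z3 t < 1]; split=> //; split.
  by apply: le_trans PE; rewrite lee_fin; lra.
move=> w /= Zw bstar bhat minb.
have Z1w : Z1 w < 1 by have := Z20 w; have := Z30 w; lra.
have Z2w : Z2 w < 1 by have := Z10 w; have := Z30 w; lra.
have Z3w : Z3 w < 1 by have := Z10 w; have := Z20 w; lra.
pose x i j := X i j w.
have opg := hZ2 _ Z2w.
have rowg v k : mulcol n d x v (g k) 0 = mulcol m d (fun i j => X (g i) j w) v k 0.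
  by rewrite !mxE.
have grow v : sqnorm v = 1 ->
    kap * m%:R / 8 <= \sum_k capped_sq (mulcol n d x v (g k) 0).
  move=> v1.
  have := capped_sq_net_transfer _ _ _ _ _ _ _ Nnet e1 opg (hZ3 _ Z3w) v v1.
  under eq_bigr do rewrite -rowg.
  have -> : 16 * 196 * m%:R * e = kap * m%:R / 8 by rewrite /e; field.
  by rewrite -/kap; lra.
have lossu : \sum_i huber (mulcol n d x (bhat - bstar) i 0 - eta i 0) <=
    \sum_i huber (- eta i 0).
  have := minb bstar; rewrite /huber_loss ler_pM2l ?invr_gt0//.
  have E b i : (data_matrix X w *m b - (data_matrix X w *m bstar + eta)) i 0 =
      mulcol n d x (b - bstar) i 0 - eta i 0.
    rewrite !mxE opprD addrA -sumrB; congr (_ - _).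
    by apply: eq_bigr => j _; rewrite !mxE mulrBr.
  under eq_bigr do rewrite E.
  under [X in _ <= X -> _]eq_bigr do rewrite E subrr.
  have mul0 i : mulcol n d x 0 i 0 = 0.
    by rewrite mxE big1// => j _; rewrite mxE mulr0.
  by under [X in _ <= X -> _]eq_bigr do rewrite mul0 sub0r.
have c0 : 0 <= kap * m%:R / 8 by rewrite !mulr_ge0// ltW.
have nD0 : 0 < n%:R * D by rewrite mulr_gt0//; lra.
have cE : K / 256 * (n%:R * D) <= (kap * m%:R / 8 / 2) ^+ 2.
  have -> : (kap * m%:R / 8 / 2) ^+ 2 = kap ^+ 2 / 256 * m%:R ^+ 2 by field.
  rewrite -CK (_ : _ * _ = kap ^+ 2 / 256 * (n%:R * (C * D))); last by field.
  by rewrite ler_wpM2l// divr_ge0// sqr_ge0.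
have := huber_localization n d m x eta g (bhat - bstar) _ _ ginj eta1 lossu
  (hZ1 _ Z1w) grow c0 _.
have -> : sqnorm (bhat - bstar) = sqnorm (bstar - bhat).
  by apply: eq_bigr => j _; rewrite -opprB mxE sqrrN.
set U := sqnorm _ => loc.
have KnD : 4 * 81 * (n%:R * D) < K / 256 * (n%:R * D) by rewrite ltr_pM2r//; lra.
have {}loc : U * (kap * m%:R / 8 / 2) ^+ 2 <= 4 * 81 * (n%:R * D) by apply: loc; lra.
rewrite mulrA ler_pdivlMr ?mulr_gt0 ?exprn_gt0//.
have U0 : 0 <= U by exact: sqnorm_ge0.
have m2 : (al * n%:R) ^+ 2 <= m%:R ^+ 2 by rewrite lerXn2r ?nnegrE// mulr_ge0// ltW.
have h : U * (al * n%:R) ^+ 2 <= U * m%:R ^+ 2 by rewrite ler_wpM2l.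
have k2 : 0 < kap ^+ 2 by rewrite exprn_gt0.
(* Clearing kap^2 and n leaves [256 * (4 * 81) < K], which is [KG]. *)
rewrite -(ler_pM2l k2) -(ler_pM2l n0).
have -> : n%:R * (kap ^+ 2 * (C * D)) = K * (n%:R * D) by rewrite -CK; ring.
have -> : n%:R * (kap ^+ 2 * (U * (al ^+ 2 * n%:R))) = kap ^+ 2 * (U * (al * n%:R) ^+ 2).
  by ring.
apply: (@le_trans _ _ (kap ^+ 2 * (U * m%:R ^+ 2))); first by rewrite ler_pM2l.
have -> : kap ^+ 2 * (U * m%:R ^+ 2) = 256 * (U * (kap * m%:R / 8 / 2) ^+ 2) by field.
by lra.
Qed.
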